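(* Let $m\geqslant4$ be an integer. Then there are no strongly regular graphs with parameters $(v,k,\lambda,\mu)$ given by $$\mu=(m-3)^3+10(m-3)^2+33(m-3)+38,$$ $$\lambda=\frac{(m-3)^5+15(m-3)^4+91(m-3)^3+283(m-3)^2}{2}+226(m-3)+148,$$ $$k=\frac{(m+1)\bigl(m(2-\mu)+2\lambda\bigr)}{2}+1,$$ $$v=1+k+\frac{k(k-\lambda-1)}{\mu}.$$
   Context: All graphs are finite, undirected and simple. A regular graph with $v$ vertices and valency $k$ is edge-regular with parameters $(v,k,\lambda)$ if any two adjacent vertices have exactly $\lambda$ common neighbors. It is amply regular with parameters $(v,k,\lambda,\mu)$ if moreover any two vertices at distance $2$ have exactly $\mu$ common neighbors. A strongly regular graph with parameters $(v,k,\lambda,\mu)$ is an amply regular graph with parameters $(v,k,\lambda,\mu)$ of diameter at most $2$ (in particular it is connected). *)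

(* Defs.v *)
From mathcomp Require Import all_boot all_order all_algebra.

Set Implicit Arguments.
Unset Strict Implicit.
Unset Printing Implicit Defensive.

Record sgraph := SGraph {
  vertex :> finType;
  adj : rel vertex;
  adj_sym : symmetric adj;
  adj_irr : irreflexive adj
}.

Definition neighbors (G : sgraph) (x : G) : {set G} := [set y | adj x y].

(* In mathcomp, [path e x p] is the walk visiting x and then the vertices of p,
   so its length (number of edges) is [size p]. *)
Definition is_walk (G : sgraph) (x y : G) (p : seq G) : Prop :=
  path (@adj G) x p /\ last x p = y.

Definition at_distance (G : sgraph) (x y : G) (d : nat) : Prop :=
  (exists2 p : seq G, is_walk x y p & size p = d) /\
  (forall p : seq G, is_walk x y p -> d <= size p).

Definition regular (G : sgraph) (k : nat) : Prop :=
  forall x : G, #|neighbors x| = k.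

Definition edge_regular (G : sgraph) (v k lambda : nat) : Prop :=
  [/\ #|G| = v, regular G k &
      forall x y : G, adj x y -> #|neighbors x :&: neighbors y| = lambda].

Definition amply_regular (G : sgraph) (v k lambda mu : nat) : Prop :=
  edge_regular G v k lambda /\
  (forall x y : G, at_distance x y 2 -> #|neighbors x :&: neighbors y| = mu).

(* Two vertices in different components are at no finite distance, so a graph
   satisfying this is connected. *)
Definition diameter_at_most (G : sgraph) (n : nat) : Prop :=
  forall x y : G, exists2 d : nat, d <= n & at_distance x y d.

Definition strongly_regular (G : sgraph) (v k lambda mu : nat) : Prop :=
  amply_regular G v k lambda mu /\ diameter_at_most G 2.

(* Main.v *)
(**
  Suppose G is such a graph.  Its smallest eigenvalue is -m, k = m g + 2 for some g, and
  the clique bound 1 + k / m shows that cliques have at most g + 1 vertices.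

  If some x has no m + 1 pairwise non-adjacent neighbours, let Y be a maximal set of
  at most m pairwise non-adjacent neighbours of x.  The neighbours of x that are adjacent
  to no vertex of Y other than y form a large clique P_y, the common closed neighbourhood
  of P_y inside N(x) is again a clique, and these at most m cliques cover N(x).  Hence
  k <= m g, a contradiction.

  So every vertex is the centre of a claw with m + 1 leaves.  The parameters make the
  Bonferroni inequality for the closed neighbourhoods of the leaves tight up to
  s = m (m - 1) / 2, and lam + 1 > (2 m - 1) (mu - 1) lets almost every pair of
  non-adjacent neighbours of u be completed to such a claw.  Thus in almost all cases a
  vertex u is adjacent to all but at most s of the common neighbours of two of its
  neighbours, as in a Terwilliger graph.  Now remove two leaves y, z from a claw at x, and
  let T be the set of neighbours of x that are not adjacent to the m - 1 other leaves.
  Each w in T adjacent to both y and z is adjacent to all of T \ N[y] or to all of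
  T \ N[z], and a double count around the centres y and z shows that fewer than
  (mu - 1 - s) / 2 vertices w are of each kind, whereas there are at least mu - 1 - s of
  them altogether.
*)

Require Import Defs.
From mathcomp Require Import all_boot all_order all_algebra.
From mathcomp Require Import zify ring.
Import Order.TTheory GRing.Theory Num.Theory.

(** * Truncated squares and double counting on finite sets *)

Lemma leq_sqr_sub a b : (a - b) ^ 2 + 2 * (a * b) <= a ^ 2 + b ^ 2.
Proof.
have [ab|ba] := ltnP a b.
  by move: (ltnW ab); rewrite -subn_eq0 => /eqP->; apply: nat_Cauchy.
by rewrite sqrnB // subnK ?nat_Cauchy.
Qed.

Section Sets.

Set Implicit Arguments.
Unset Strict Implicit.

Variable T : finType.
Implicit Types (A B : {set T}) (F : T -> T -> bool).

Lemma sum_card_count A B (F : T -> T -> bool) :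
  \sum_(w in A) #|[set y in B | F w y]| = \sum_(y in B) #|[set w in A | F w y]|.
Proof.
under eq_bigr => w _ do rewrite -sum1dep_card.
under [RHS]eq_bigr => y _ do rewrite -sum1dep_card.
rewrite (exchange_big_dep (mem B)) /=; last by move=> ? ? _ /andP[].
by apply: eq_bigr => y By; apply: eq_bigl => w; rewrite By.
Qed.

Lemma sum_card_sq A B (F : T -> T -> bool) :
  \sum_(w in A) #|[set y in B | F w y]| ^ 2 =
  \sum_(y in B) \sum_(z in B) #|[set w in A | F w y && F w z]|.
Proof.
transitivity (\sum_(w in A) \sum_(y in B) F w y * #|[set z in B | F w z]|).
  apply: eq_bigr => w _; rewrite -mulnn -big_distrl /=; congr (_ * _).
  by rewrite -big_mkcondr /= sum1dep_card.
rewrite exchange_big; apply: eq_bigr => y _ /=.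
rewrite -[RHS](sum_card_count A B (fun w z => F w y && F w z)).
apply: eq_bigr => w _; case: (F w y); last first.
  by rewrite mul0n; apply/esym/eqP; rewrite cards_eq0; apply/eqP/setP=> z; rewrite !inE andbF.
by rewrite mul1n.
Qed.

Lemma leq_card_bigcup (I : finType) (P : {set I}) (F : I -> {set T}) c :
  (forall i, i \in P -> #|F i| <= c) -> #|\bigcup_(i in P) F i| <= #|P| * c.
Proof.
move=> Fc; rewrite -sum_nat_const.
elim/big_rec2: _ => [|i n A Pi le_nA]; first by rewrite cards0.
by apply: leq_trans (leq_card_setU _ _) _; rewrite leq_add ?Fc.
Qed.

End Sets.

(** * Counting inside the neighbourhood of a vertex *)

Section Claws.

Set Implicit Arguments.
Unset Strict Implicit.

(* [M] is [mu - 1]; [s] is the Bonferroni slack [m * (m - 1) / 2] of an [(m+1)]-claw. *)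
Variables (G : sgraph) (k lam M m s : nat).
Implicit Types (u x y z w a b t : G) (B Q S Y Z : {set G}).

Local Notation N := (@neighbors G).
Definition cnbr x : {set G} := x |: N x.
Local Notation C := cnbr.

Hypothesis degree : forall x, #|N x| = k.
Hypothesis card_adj : forall x y, adj x y -> #|N x :&: N y| = lam.
Hypothesis card_nadj : forall x y, y \notin C x -> #|N x :&: N y| = M.+1.

Lemma in_nbr x y : (y \in N x) = adj x y. Proof. by rewrite inE. Qed.
Lemma in_cnbr x y : (y \in C x) = (y == x) || adj x y. Proof. by rewrite !inE. Qed.
Lemma cnbrC x y : (y \in C x) = (x \in C y).
Proof. by rewrite !in_cnbr eq_sym adj_sym. Qed.
Lemma cnbr_id x : x \in C x. Proof. by rewrite in_cnbr eqxx. Qed.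
Lemma nbr_irr x : x \in N x = false. Proof. by rewrite inE adj_irr. Qed.
Lemma nbr_cnbr x y : y \in N x -> y \in C x.
Proof. by rewrite in_cnbr in_nbr => ->; rewrite orbT. Qed.

Definition stable Y := forall a b, a \in Y -> b \in Y -> a != b -> b \notin C a.

Definition stableb Y := [forall a in Y, forall b in Y, (a != b) ==> (b \notin C a)].

Lemma stableP Y : reflect (stable Y) (stableb Y).
Proof.
apply: (iffP forall_inP) => [st a b Ya Yb ab|st a Ya].
  by have /forall_inP/(_ b Yb)/implyP-> := st a Ya.
by apply/forall_inP => b Yb; apply/implyP; apply: st.
Qed.

Definition deg_in Y w := #|[set y in Y | w \in C y]|.

(** For non-adjacent neighbours [y], [z] of [u], this vanishes in a Terwilliger graph, where [u]
    sees all their other common neighbours. *)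
Definition excess u y z := #|(N y :&: N z) :\: C u|.

Lemma excessC u y z : excess u y z = excess u z y.
Proof. by rewrite /excess setIC. Qed.

Lemma card_local_cnbr u y : y \in N u -> #|N u :&: C y| = lam.+1.
Proof.
move=> uy; have -> : N u :&: C y = y |: (N u :&: N y).
  by apply/setP=> w; rewrite !inE; case: eqVneq => // ->; rewrite -in_nbr uy.
by rewrite cardsU1 !inE adj_irr andbF card_adj ?add1n // -in_nbr.
Qed.

(** The [M + 1] common neighbours of [y] and [z] are [u] itself, those inside [N u], and those
    counted by [excess]. *)
Lemma card_local_nadj u y z : y \in N u -> z \in N u -> z \notin C y ->
  #|N u :&: C y :&: C z| + excess u y z = M.
Proof.
move=> uy uz yz; apply: succn_inj; rewrite -(card_nadj yz) /excess.
rewrite -(cardsID (C u) (N y :&: N z)) -addSn; congr (_ + _).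
have -> : (N y :&: N z) :&: C u = u |: (N u :&: C y :&: C z).
  apply/setP=> w; move: uy uz yz; rewrite !in_setU1 !in_setI !in_nbr !in_cnbr.
  rewrite negb_or => uy uz /andP[zy yz].
  case: (eqVneq w u) => [->|wu] /=; first by rewrite !(adj_sym _ u) uy uz.
  case: (eqVneq w y) => [->|wy] /=.
    by rewrite adj_irr eq_sym (negPf zy) adj_sym (negPf yz) !andbF.
  case: (eqVneq w z) => [->|wz] /=; first by rewrite (negPf yz) andbF.
  by rewrite andbC andbA.
by rewrite cardsU1 !inE adj_irr.
Qed.

Lemma card_local_nadj_le u y z : y \in N u -> z \in N u -> z \notin C y ->
  #|N u :&: C y :&: C z| <= M.
Proof. by move=> uy uz yz; rewrite -(card_local_nadj uy uz yz) leq_addr. Qed.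

(* [d ^ 2 + 2 - 3 * d] is [(d - 1) * (d - 2)], so the first sum measures the defect in
   the Bonferroni inequality for the covering of [N u] by the sets [C y], [y] in [Y]. *)
Lemma claw_count u Y : Y \subset N u -> stable Y ->
  \sum_(w in N u) (deg_in Y w ^ 2 + 2 - 3 * deg_in Y w)
    + \sum_(y in Y) \sum_(z in Y :\ y) excess u y z + 2 * (#|Y| * lam.+1)
  = 2 * k + #|Y| * (#|Y|.-1 * M).
Proof.
move=> /subsetP Yu Yst.
have sum1 : \sum_(w in N u) deg_in Y w = #|Y| * lam.+1.
  rewrite sum_card_count -sum_nat_const; apply: eq_bigr => y /Yu uy.
  by rewrite -(card_local_cnbr uy); apply: eq_card => w; rewrite !in_setI inE.
have sum2 : \sum_(w in N u) deg_in Y w ^ 2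
    + \sum_(y in Y) \sum_(z in Y :\ y) excess u y z
    = #|Y| * lam.+1 + #|Y| * (#|Y|.-1 * M).
  rewrite sum_card_sq -big_split -!sum_nat_const -big_split /=.
  apply: eq_bigr => y Yy; rewrite (big_setD1 y) //= -addnA -big_split /=.
  have -> : [set w in N u | (w \in C y) && (w \in C y)] = N u :&: C y.
    by apply/setP => w; rewrite !in_setI inE andbb.
  rewrite card_local_cnbr ?Yu //; congr (_ + _).
  have -> : #|Y|.-1 = #|Y :\ y| by rewrite (cardsD1 y Y) Yy.
  rewrite -sum_nat_const; apply: eq_bigr => z; rewrite !inE => /andP[zy Yz].
  rewrite -(@card_local_nadj u y z) ?Yu //; last by apply: Yst; rewrite // eq_sym.
  by congr (_ + _); apply: eq_card => w; rewrite !in_setI inE andbA.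
have : \sum_(w in N u) (deg_in Y w ^ 2 + 2 - 3 * deg_in Y w)
   + 3 * \sum_(w in N u) deg_in Y w = \sum_(w in N u) deg_in Y w ^ 2 + 2 * k.
  rewrite -(degree u) [2 * _]mulnC -sum_nat_const big_distrr -!big_split /=.
  by apply: eq_bigr => w _; apply: subnK; case: (deg_in Y w) => [|[|[|d]]] //; nia.
move: sum1 sum2; lia.
Qed.

(** * Numerical constraints on claws *)

Hypotheses (m_ge4 : 4 <= m) (s_gt0 : 0 < s) (s_def : s * 2 = m * m.-1).
Hypothesis k_eq : 2 * k + m.+1 * (m * M) = 2 * (m.+1 * lam.+1) + m * m.-1.
Hypotheses (lam_big : 2 * (m * M) <= lam + M) (sM : 10 * s <= M).

(** By [k_eq], the two non-negative sums in [claw_count] would total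
    [2 * s + 2 * (m + 1) * M - 2 * (lam + 1)], which is negative by [lam_big] and [sM]. *)
Lemma no_big_claw u Y : Y \subset N u -> stable Y -> #|Y| != m.+2.
Proof.
move=> Yu Yst; apply/eqP => cY; have := claw_count Yu Yst; rewrite cY /=.
have : 4 * M <= m * M by rewrite leq_mul2r m_ge4 orbT.
move: k_eq s_def s_gt0 lam_big sM; lia.
Qed.

(** For [m + 1] leaves, [k_eq] makes the two sums in [claw_count] total exactly [2 * s]. A vertex of
    degree above 2 contributes at least 2, and the pair [y], [z] is counted in both orders. *)
Lemma claw_slack u Y y z : Y \subset N u -> stable Y -> #|Y| = m.+1 ->
  y \in Y -> z \in Y -> y != z ->
  excess u y z + #|[set w in N u | 2 < deg_in Y w]| <= s.
Proof.
move=> Yu Yst cY Yy Yz yz; have := claw_count Yu Yst; rewrite cY /=.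
have : 2 * #|[set w in N u | 2 < deg_in Y w]| <=
   \sum_(w in N u) (deg_in Y w ^ 2 + 2 - 3 * deg_in Y w).
  rewrite mulnC -sum_nat_const.
  under eq_bigl => w do rewrite inE.
  rewrite [X in _ <= X](bigID (fun w => 2 < deg_in Y w)) /=.
  apply: leq_trans (leq_addr _ _); apply: leq_sum => w /andP[_].
  by case: (deg_in Y w) => [|[|[|d]]] // _; nia.
have : 2 * excess u y z <= \sum_(y in Y) \sum_(z in Y :\ y) excess u y z.
  have le1 a b : b \in Y -> a != b -> excess u a b <= \sum_(c in Y :\ a) excess u a c.
    by move=> Yb ab; rewrite (big_setD1 b) ?leq_addr // !inE eq_sym ab.
  rewrite (big_setD1 y) //= mul2n -addnn {2}excessC; apply: leq_add; first exact: le1.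
  rewrite (big_setD1 z) /=; last by rewrite !inE eq_sym yz.
  by apply: leq_trans (leq_addr _ _); apply: le1; rewrite // eq_sym.
move: k_eq s_def; lia.
Qed.

Lemma notin_far Y a : (forall t, t \in Y -> t \notin C a) -> a \notin Y.
Proof. by move=> Ya; apply/negP => /Ya; rewrite cnbr_id. Qed.

Lemma stableU1 Y a :
  stable Y -> (forall t, t \in Y -> t \notin C a) -> stable (a |: Y).
Proof.
move=> Yst Ya b c /setU1P[->|Yb] /setU1P[->|Yc] bc; rewrite ?Ya //.
- by rewrite eqxx in bc.
- by rewrite cnbrC Ya.
exact: Yst.
Qed.

(** * Neighbours far from a claw with two leaves removed *)

Definition base u Z := [/\ Z \subset N u, stable Z & #|Z| = m.-1].

Definition far u Z := [set w in N u | [forall t in Z, t \notin C w]].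

Lemma farP u Z w :
  reflect (w \in N u /\ forall t, t \in Z -> t \notin C w) (w \in far u Z).
Proof.
rewrite /far in_set; apply: (iffP andP) => -[uw wZ]; split=> //.
  exact/forall_inP.
exact/forall_inP.
Qed.

Lemma far_sub u Z : far u Z \subset N u.
Proof. by apply/subsetP => w /farP[]. Qed.

(** A vertex of [N u :&: C a] outside [far u Z] lies in [C t] for some [t] in [Z]; as [t] is not
    adjacent to [a], each [t] accounts for at most [M] of them. *)
Lemma far_cnbr_ge u Z a : Z \subset N u -> a \in far u Z ->
  lam.+1 <= #|far u Z :&: C a| + #|Z| * M.
Proof.
move=> /subsetP Zu Ta; have [ua aZ] := farP _ _ _ Ta.
rewrite -(card_local_cnbr ua) -(cardsID (far u Z)).
apply: leq_add.
  by rewrite subset_leq_card //; apply/subsetP => w; rewrite !in_setI andbC => /and3P[-> _ ->].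
apply: (@leq_trans #|\bigcup_(t in Z) (N u :&: C a :&: C t)|).
  apply/subset_leq_card/subsetP => w; rewrite in_setD !in_setI.
  move=> /andP[Tw /andP[uw aw]].
  move: Tw; rewrite /far in_set uw /= negb_forall => /existsP[t].
  rewrite negb_imply negbK => /andP[Zt wt]; apply/bigcupP; exists t => //.
  by rewrite !in_setI uw aw cnbrC.
apply: leq_card_bigcup => t Zt.
by apply: (card_local_nadj_le ua); [exact: Zu|exact: aZ].
Qed.

Section Far.

Variables (u : G) (Z : {set G}).
Hypothesis uZ : base u Z.
Local Notation T := (far u Z).

Lemma far_claw a b : a \in T -> b \in T -> b \notin C a ->
  [/\ a |: (b |: Z) \subset N u, stable (a |: (b |: Z)) & #|a |: (b |: Z)| = m.+1].
Proof.
move=> /farP[ua aZ] /farP[ub bZ] ab; have [Zu Zst cZ] := uZ.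
have aZ' t : t \in b |: Z -> t \notin C a by case/setU1P => [->|/aZ].
split; first by rewrite !subUset !sub1set ua ub.
  by do 2!apply: stableU1 => //.
by rewrite !cardsU1 (notin_far aZ') (notin_far bZ) cZ; lia.
Qed.

(** Otherwise [Z] together with [a], [b], [c] would be a stable set of [m + 2] neighbours of [u]. *)
Lemma far_noind3 a b c : a \in T -> b \in T -> c \in T ->
  b \notin C a -> c \notin C a -> c \in C b.
Proof.
move=> Ta Tb Tc ab ac; apply/negPn/negP => bc.
have [Yu Yst cY] := far_claw Tb Tc bc; have [ua aZ] := farP _ _ _ Ta.
have aY t : t \in b |: (c |: Z) -> t \notin C a.
  by case/setU1P => [->|/setU1P[->|/aZ]].
have : #|a |: (b |: (c |: Z))| == m.+2 by rewrite cardsU1 (notin_far aY) cY add1n.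
apply/negP/(no_big_claw (u := u)); last exact: stableU1.
by rewrite subUset sub1set ua.
Qed.

Lemma far_common_le a b : a \in T -> b \in T -> b \notin C a ->
  #|T :&: C a :&: C b| <= M.
Proof.
move=> /farP[ua _] /farP[ub _] ab.
apply: leq_trans (card_local_nadj_le ua ub ab).
by rewrite subset_leq_card // !setSI // far_sub.
Qed.

(** The losses are of two kinds: common neighbours outside [C u], and those in [N u] that also see
    some [t] in [Z] and so see three leaves. [claw_slack] bounds both together by [s]. *)
Lemma far_common_ge a b : a \in T -> b \in T -> b \notin C a ->
  M <= #|T :&: C a :&: C b| + s.
Proof.
move=> Ta Tb ab; have [Yu Yst cY] := far_claw Ta Tb ab.
have [ua aZ] := farP _ _ _ Ta; have [ub bZ] := farP _ _ _ Tb.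
have aNb : a != b by apply: contraNneq ab => ->; rewrite cnbr_id.
set Y := a |: _ in Yu Yst cY.
have Ya : a \in Y by rewrite setU11.
have Yb : b \in Y by rewrite setU1r // setU11.
have := claw_slack Yu Yst cY Ya Yb aNb.
rewrite -[X in X <= _ + s](card_local_nadj ua ub ab) -(cardsID T (N u :&: C a :&: C b)).
have -> : (N u :&: C a :&: C b) :&: T = T :&: C a :&: C b.
  apply/setP=> w; rewrite !in_setI; case Tw: (w \in T); rewrite ?andbF ?andbT //.
  by rewrite (subsetP (far_sub u Z) _ Tw).
suff : #|(N u :&: C a :&: C b) :\: T| <= #|[set w in N u | 2 < deg_in Y w]| by clear; lia.
apply/subset_leq_card/subsetP => w; rewrite in_setD !in_setI in_set.
move=> /andP[Tw /andP[/andP[uw aw] bw]]; rewrite uw /=.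
move: Tw; rewrite /far in_set uw /= negb_forall => /existsP[t].
rewrite negb_imply negbK => /andP[Zt wt].
have ta : t != a by apply: contraTneq Zt => ->; exact: notin_far.
have tb : t != b by apply: contraTneq Zt => ->; exact: notin_far.
have <- : #|a |: [set b; t]| = 3.
  by rewrite cardsU1 cards2 !inE !negb_or aNb eq_sym ta eq_sym tb.
have Yt : t \in Y by rewrite !in_setU1 Zt !orbT.
apply/subset_leq_card/subsetP => c /setU1P[|/set2P[]] ->; rewrite in_set.
- by rewrite Ya.
- by rewrite Yb.
by rewrite Yt cnbrC.
Qed.

Lemma far_diff_ge a b : a \in T -> b \in T -> b \notin C a ->
  lam.+1 <= #|T :\: C b| + m * M.
Proof.
move=> Ta Tb ab; have [Zu _ cZ] := uZ.
have := far_cnbr_ge Zu Ta; have := far_common_le Ta Tb ab; rewrite cZ.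
rewrite -(cardsID (C b) (T :&: C a)).
have : #|(T :&: C a) :\: C b| <= #|T :\: C b|.
  by rewrite subset_leq_card // setSD // subsetIl.
have : m * M = m.-1 * M + M by rewrite addnC -mulSn prednK // (leq_trans _ m_ge4).
move: lam_big; clear; lia.
Qed.

Lemma far_big a b : a \in T -> b \in T -> b \notin C a -> lam.+1 < #|T|.
Proof.
move=> Ta Tb ab; have [Zu _ cZ] := uZ.
have := far_diff_ge Ta Tb ab; have := far_cnbr_ge Zu Tb; rewrite cZ.
rewrite -(cardsID (C b) T).
have : m * M = m.-1 * M + M by rewrite addnC -mulSn prednK // (leq_trans _ m_ge4).
move: lam_big; clear; lia.
Qed.

Lemma far_nonadj a b c : a \in T -> b \in T -> b \notin C a -> c \in T ->
  exists2 d, d \in T & d \notin C c.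
Proof.
move=> Ta Tb ab Tc; apply/subsetPn; apply/negP => TC.
have := far_big Ta Tb ab; rewrite ltnNge -(card_local_cnbr (u := u) (y := c)).
  by rewrite subset_leq_card // subsetI far_sub.
by case/farP: Tc.
Qed.

End Far.

(** * Exchanging leaves of a claw *)

Definition claw u Y := [/\ Y \subset N u, stable Y & #|Y| = m.+1].

Lemma claw_base u Y y z : claw u Y -> y \in Y -> z \in Y -> y != z ->
  [/\ base u (Y :\: [set y; z]), y \in far u (Y :\: [set y; z]),
      z \in far u (Y :\: [set y; z]) & z \notin C y].
Proof.
move=> [Yu Yst cY] Yy Yz yz; set Z := Y :\: _.
have ZY t : t \in Z -> [/\ t \in Y, t != y & t != z].
  by rewrite !inE negb_or => /andP[/andP[]].
split; last exact: Yst.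
- split; first by apply: subset_trans Yu; rewrite subsetDl.
    by move=> a b /ZY[Ya _ _] /ZY[Yb _ _]; apply: Yst.
  have sYZ : [set y; z] \subset Y by rewrite subUset !sub1set Yy Yz.
  by rewrite cardsD (setIidPr sYZ) cards2 yz cY; (clear -m_ge4; lia).
- apply/farP; split; first exact: (subsetP Yu).
  by move=> t /ZY[Yt ty _]; apply: Yst; rewrite // eq_sym.
- apply/farP; split; first exact: (subsetP Yu).
  by move=> t /ZY[Yt _ tz]; apply: Yst; rewrite // eq_sym.
Qed.

Lemma pair_cover (A B : {set G}) : A \subset B -> #|A| <= 2 -> 1 < #|B| ->
  exists y z, [/\ y \in B, z \in B, y != z & A \subset [set y; z]].
Proof.
move=> AB; rewrite leq_eqVlt => /orP[/cards2P[y [z [yz eA]]] _|A1 B2].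
  exists y, z; move: AB; rewrite eA subUset !sub1set => /andP[By Bz].
  by split.
have [->|[y Ay]] := set_0Vmem A.
  by case/card_gt1P: B2 => y [z [By Bz yz]]; exists y, z; split=> //; apply: sub0set.
have [z Bz zy] : exists2 z, z \in B & z != y.
  case/card_gt1P: B2 => z [t [Bz Bt zt]].
  by have [zy|] := eqVneq z y; [exists t; rewrite // -zy eq_sym | exists z].
exists y, z; split=> //; [exact: (subsetP AB) | by rewrite eq_sym |].
apply/subsetP => t At; apply/set2P; left.
by move: A1; rewrite ltnS => /card_le1_eqP/(_ y t Ay At).
Qed.

(** Two leaves other than [w] are removed so that [a] is far from all the rest; [far_nonadj] then
    supplies a second new leaf next to [a]. *)
Lemma claw_through u Y a w : claw u Y -> a \in N u -> deg_in Y a <= 2 ->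
  w \in Y -> w \notin C a -> exists Y', [/\ claw u Y', a \in Y' & w \in Y'].
Proof.
move=> uY ua aY Yw aw; have [Yu Yst cY] := uY.
have [||y [z [Yy Yz yz sD]]] := pair_cover (B := Y :\ w) _ aY.
- apply/subsetP => t; rewrite !inE => /andP[-> ta]; rewrite andbT.
  by apply: contraNneq aw => <-; rewrite cnbrC in_cnbr.
- by move: cY; rewrite (cardsD1 w Y) Yw; move: m_ge4; clear; lia.
move: Yy Yz; rewrite !in_setD1 => /andP[yw Yy] /andP[zw Yz].
have [Zb Ty Tz zy] := claw_base uY Yy Yz yz; set Z := Y :\: _ in Zb Ty Tz.
have Ta : a \in far u Z.
  apply/farP; split=> // t; rewrite in_setD => /andP[tD Yt].
  by apply: contra tD => ta; apply: (subsetP sD); rewrite in_set Yt cnbrC.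
have [d Td ad] := far_nonadj Zb Ty Tz zy Ta.
exists (a |: (d |: Z)); split; first exact: far_claw.
  exact: setU11.
by rewrite !in_setU1 in_setD in_set2 Yw negb_or !(eq_sym w) yw zw !orbT.
Qed.

Lemma claw_big u Y : claw u Y -> #|[set w in N u | 2 < deg_in Y w]| <= s.
Proof.
move=> [Yu Yst cY]; have /card_gt1P[y [z [Yy Yz yz]]] : 1 < #|Y| by rewrite cY; (clear -m_ge4; lia).
by have := claw_slack Yu Yst cY Yy Yz yz; (clear -m_ge4; lia).
Qed.

(* A vertex adjacent to at most two leaves of a claw at [u] can be exchanged into the
   claw, and [excess u a w <= s] as soon as [a] and [w] are leaves of a common claw. *)
Lemma few_excess u Y : claw u Y -> exists2 B : {set G}, #|B| <= s &
  forall w, w \in N u -> w \notin B ->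
    #|[set a in N u :\: C w | s < excess u a w]| <= s.
Proof.
move=> uY; have [_ _ cY] := uY.
exists [set w in N u | 2 < deg_in Y w]; first exact: claw_big.
move=> w uw; rewrite in_set uw /= -leqNgt => wY.
have [w0 Yw0 ww0] : exists2 w0, w0 \in Y & w0 \notin C w.
  apply/subsetPn; apply: contraTN wY => /subsetP YC; rewrite -ltnNge.
  have -> : deg_in Y w = #|Y|; last by rewrite cY; (clear -m_ge4; lia).
  apply: eq_card => t; rewrite in_set cnbrC.
  by case Yt : (t \in Y) => //=; apply: YC.
(* First [w] is made a leaf. Then every [a] that sees at most two leaves of [Y1] can be exchanged in
   while [w] stays, so only the others are exceptional. *)
have [Y1 [uY1 Y1w _]] := claw_through uY uw wY Yw0 ww0.
apply: leq_trans (claw_big uY1); apply/subset_leq_card/subsetP => a.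
rewrite in_set in_setD => /andP[/andP[aw ua] ex_aw]; rewrite in_set ua /= ltnNge.
apply: contraL ex_aw => aY1; rewrite -leqNgt.
have [|Y2 [[Y2u Y2st cY2] Y2a Y2w]] := claw_through uY1 ua aY1 Y1w.
  by rewrite cnbrC.
have a_w : a != w by apply: contraNneq aw => ->; rewrite cnbr_id.
by have := claw_slack Y2u Y2st cY2 Y2a Y2w a_w; (clear -m_ge4; lia).
Qed.

(** * Vertices adjacent to both removed leaves *)

Section Pair.

Variables (x : G) (Z : {set G}) (y z : G).
Hypothesis xZ : base x Z.
Local Notation T := (far x Z).
Hypotheses (Ty : y \in T) (Tz : z \in T) (yz : z \notin C y).

(** No vertex of [T] misses both [a] and [b], by [far_noind3], so the three sets partition [T]. *)
Lemma far_delta a b : a \in T -> b \in T -> b \notin C a ->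
  #|T :\: C a| + #|T :\: C b| + #|T :&: C a :&: C b| = #|T|.
Proof.
move=> Ta Tb ab; rewrite -[RHS](cardsID (C a)) -[#|T :&: C a|](cardsID (C b)).
have -> : (T :&: C a) :\: C b = T :\: C b; last by clear; lia.
apply/setP=> t; rewrite !in_setD in_setI; case tb: (t \in C b) => //=.
case Tt: (t \in T) => //=; apply/negPn/negP => ta.
by move: (far_noind3 xZ Ta Tb Tt ab ta); rewrite tb.
Qed.

Lemma far_delta_le a b : a \in T -> b \in T -> b \notin C a ->
  #|T :\: C a| + #|T :\: C b| + M <= #|T| + s.
Proof.
by move=> Ta Tb ab; have := far_delta Ta Tb ab; have := far_common_ge xZ Ta Tb ab; clear; lia.
Qed.

Lemma far_delta_ge a b : a \in T -> b \in T -> b \notin C a ->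
  #|T| <= #|T :\: C a| + #|T :\: C b| + M.
Proof.
by move=> Ta Tb ab; have := far_delta Ta Tb ab; have := far_common_le Ta Tb ab; clear; lia.
Qed.

Lemma far_diff_gt a b : a \in T -> b \in T -> b \notin C a -> 3 * M < #|T :\: C b|.
Proof.
move=> Ta Tb ab; have := far_diff_ge xZ Ta Tb ab.
have : 4 * M <= m * M by rewrite leq_mul2r m_ge4 orbT.
move: lam_big; clear; lia.
Qed.

(** Otherwise [w] misses at most [M] vertices of [T], so a non-neighbour [a] misses at least
    [|T| - 2 * M], among them some [b] non-adjacent to [y] or [z]. This [b] misses at most [M + s],
    whereas any vertex of [T] non-adjacent to [y] or [z] misses more than [2 * M]. *)
Lemma common_nonadj w : w \in T :&: C y :&: C z ->
  exists2 a, a \in T & a \notin C w /\ (a \notin C y \/ a \notin C z).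
Proof.
rewrite !in_setI => /andP[/andP[Tw wy] wz].
pose W := T :&: C y :&: C z; have zy : y \notin C z by rewrite cnbrC.
have dich c : c \in T -> #|T :\: C c| <= M \/
    exists2 a, a \in T & a \notin C c /\ (a \notin C y \/ a \notin C z).
  move=> Tc; have [sub|] := boolP (T :\: C c \subset W).
    left; apply: leq_trans (subset_leq_card sub) _.
    exact: (far_common_le Ty Tz yz).
  case/subsetPn => a; rewrite in_setD => /andP[ac Ta]; rewrite !in_setI Ta negb_and.
  by move=> /orP aW; right; exists a.
have [dw|//] := dich w Tw.
have [a Ta wa] := far_nonadj xZ Ty Tz yz Tw.
have Ddif := far_diff_gt Tz Ty zy; have Udif := far_diff_gt Ty Tz yz.
have n_ge := far_delta Ty Tz yz.
have a_ge := far_delta_ge Tw Ta wa.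
have [da|[b Tb [ab yzb]]] := dich a Ta.
  by move: dw da Ddif Udif n_ge a_ge; clear; lia.
have ab_le := far_delta_le Ta Tb ab.
move: dw Ddif Udif n_ge a_ge ab_le sM.
case: yzb => [yb|zb].
  by have := far_delta_ge Ty Tb yb; clear; lia.
by have := far_delta_ge Tz Tb zb; clear; lia.
Qed.

Lemma common_split w : w \in T :&: C y :&: C z ->
  (T :\: C y \subset C w) || (T :\: C z \subset C w).
Proof.
rewrite !in_setI => /andP[/andP[Tw wy] wz]; apply/negPn/negP; rewrite negb_or.
case/andP=> /subsetPn[v + wv] /subsetPn[a + wa].
rewrite !in_setD => /andP[yv Tv] /andP[za Ta].
(* By [far_noind3], a vertex missed by [w] sees both [v] and [a], and also [y] or [z]. *)
have le2 : #|T :\: C w| <= M + M.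
  apply: leq_trans (leq_add (far_common_le Ty Tv yv) (far_common_le Tz Ta za)).
  apply: leq_trans (leq_card_setU _ _); apply/subset_leq_card/subsetP => t.
  rewrite in_setD in_setU !in_setI => /andP[wt Tt]; rewrite Tt /=.
  rewrite (far_noind3 xZ Tw Tv Tt wv wt) (far_noind3 xZ Tw Ta Tt wa wt) !andbT.
  by apply/negPn/negP; rewrite negb_or => /andP[/(far_noind3 xZ Ty Tz Tt yz)->].
have := far_delta_ge Tw Ta wa; have := far_delta_le Tz Ta za.
have := far_diff_gt Ty Tz yz; move: le2 sM; clear; lia.
Qed.

(** Double count of pairs [w], [a] with [F w a], where [a] lies in [U] and both are neighbours of
    [y]: a typical [w] has almost all of [U] as partners, but each [a] has at most [2 * s]
    partners. *)
Lemma common_side_lt Y : claw y Y ->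
  2 * #|[set w in T :&: C y :&: C z | T :\: C y \subset C w]| + s < M.
Proof.
move=> yY; have [B cB goodB] := few_excess yY; have zy : y \notin C z by rewrite cnbrC.
set WD := [set w in _ | _].
set U := T :\: C z; set D := T :\: C y.
have WDP w : w \in WD -> [/\ w \in T, w \in C y, w \in C z & D \subset C w].
  by rewrite in_set !in_setI => /andP[/andP[/andP[]]].
have UP a : a \in U -> [/\ a \in T, a \notin C z & a \in C y].
  rewrite in_setD => /andP[za Ta]; split=> //.
  by apply: contraTT isT => ya; move: za; rewrite (far_noind3 xZ Ty Tz Ta yz ya).
pose F w a := (a \notin C w) && (excess y a w <= s).
have Uw w : w \in WD :\: B -> #|U| <= #|[set a in U | F w a]| + (2 * s + M).
  rewrite in_setD => /andP[Bw WDw]; have [Tw yw zw Dw] := WDP _ WDw.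
  have Ww : w \in T :&: C y :&: C z by rewrite !in_setI Tw yw.
  (* Since [w] sees all of [D], the vertex [b] misses [z] as well as [w]; comparing both with [b]
     shows that [w] misses almost as many vertices as [z]. *)
  have Uw : #|U| <= #|T :\: C w| + s.
    have [b Tb [wb []]] := common_nonadj Ww.
      by move=> yb; rewrite (subsetP Dw) // in_setD yb in wb.
    move=> zb; have := far_delta_ge Tw Tb wb; have := far_delta_le Tz Tb zb.
    rewrite -/U; clear; lia.
  have yw' : w \in N y.
    by move: yw; rewrite in_cnbr in_nbr => /predU1P[wy|//]; rewrite wy (negPf zy) in zw.
  have := goodB w yw' Bw; set E := [set a in _ | _] => cE.
  have cU : #|U :\: C w| <= #|[set a in U | F w a]| + s.
    rewrite -(cardsID [set a in U | F w a]) leq_add ?subset_leq_card ?subsetIr //.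
    apply: leq_trans cE; apply/subset_leq_card/subsetP => a.
    rewrite in_setD in_set in_setD => /andP[+ /andP[wa Ua]].
    rewrite Ua /F wa /= -ltnNge => ex_aw.
    have [Ta za ya] := UP _ Ua; rewrite /E in_set in_setD wa ex_aw andbT.
    by move: ya; rewrite in_cnbr in_nbr => /predU1P[ay|//]; rewrite ay cnbrC yw in wa.
  have cT : #|T :\: C w| <= #|U :\: C w| + M.
    apply: leq_trans (leq_add (leqnn _) (far_common_le Ty Tz yz)).
    apply: leq_trans (leq_card_setU _ _); apply/subset_leq_card/subsetP => t.
    rewrite in_setU !in_setI !in_setD => /andP[wt Tt]; rewrite wt Tt andbT /=.
    case: (boolP (t \in C z)) => //= zt; rewrite andbT; apply: contraNT wt => yt.
    by rewrite (subsetP Dw) // in_setD yt.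
  by move: Uw cU cT; clear; lia.
have Ua a : a \in U -> #|[set w in WD :\: B | F w a]| <= 2 * s.
  move=> Ua; have [Ta za ya] := UP _ Ua.
  have [->|[w]] := set_0Vmem [set w in WD :\: B | F w a]; first by rewrite cards0.
  rewrite in_set in_setD => /andP[/andP[_ WDw] /andP[aw ex_aw]].
  have [Tw yw zw Dw] := WDP _ WDw.
  (* A vertex of [D] that sees [a] also sees [w] but not [y], so it is counted by [excess y a w]. *)
  have cD : #|D :&: C a| <= s.
    apply: leq_trans ex_aw; apply/subset_leq_card/subsetP => v.
    rewrite in_setI => /andP[Dv av].
    have wv := subsetP Dw _ Dv; move: Dv; rewrite {1}/D in_setD => /andP[yv Tv].
    rewrite in_setD yv in_setI /=; move: av wv; rewrite !in_cnbr !in_nbr.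
    case/predU1P=> [va|->]; first by rewrite va ya in yv.
    by case/predU1P=> [vw|->//]; rewrite vw yw in yv.
  have cW : #|[set w in WD :\: B | F w a]| <= #|(T :&: C y :&: C z) :\: C a|.
    apply/subset_leq_card/subsetP => t; rewrite in_set in_setD.
    case/andP=> /andP[_ /WDP[Tt yt zt _]] /andP[at_ _].
    by rewrite in_setD !in_setI Tt yt zt cnbrC at_.
  (* These sets are disjoint, and [|T :\: C a| <= |D| + s] because [a] and [y] both miss [z]. Hence
     at most [2 * s] partners [w] remain. *)
  have cT : #|(T :&: C y :&: C z) :\: C a| + #|D :\: C a| <= #|T :\: C a|.
    rewrite -cardsUI [X in _ + X](_ : _ = 0) ?addn0.
      by rewrite subset_leq_card // -setDUl setSD // subUset subsetDl -setIA subsetIl.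
    apply/eqP; rewrite cards_eq0; apply/eqP/setP => t.
    by rewrite in_set0 !(in_setI, in_setD); case: (t \in C y); rewrite ?andbF.
  have := cardsID (C a) D; have := far_delta_le Tz Ta za; have := far_delta Ty Tz yz.
  have := far_common_le Ty Tz yz; move: cD cW cT; rewrite -/U -/D; clear; lia.
have : #|WD :\: B| * (#|U| - (2 * s + M)) <= #|U| * (2 * s).
  apply: (@leq_trans (\sum_(w in WD :\: B) #|[set a in U | F w a]|)).
    by rewrite -sum_nat_const; apply: leq_sum => w /Uw; clear; lia.
  by rewrite sum_card_count -sum_nat_const; apply: leq_sum.
have : #|WD| <= #|WD :\: B| + s.
  by rewrite -(cardsID B WD) addnC leq_add2l (leq_trans _ cB) // subset_leq_card // subsetIr.
(* From [|U| > 3 * M] and [M >= 10 * s], fewer than [10 * s / 3] vertices of [WD] lie outside [B],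
   so [2 * |WD| + s] is below [29 * s / 3]. *)
have := far_diff_gt Ty Tz yz; rewrite -/U.
move: sM s_gt0; clear; nia.
Qed.

End Pair.

(** By [common_split] the two sides cover all common vertices, so there are fewer than [M - s] of
    them, against [far_common_ge]. *)
Lemma not_all_claws : 0 < #|G| -> ~ forall u, exists Y, claw u Y.
Proof.
case/card_gt0P => x _ claws; have [Y xY] := claws x.
have [y [z [Yy Yz yz]]] : exists y z, [/\ y \in Y, z \in Y & y != z].
  by apply/card_gt1P; have [_ _ ->] := xY; move: m_ge4; clear; lia.
have [xZ Ty Tz zy'] := claw_base xY Yy Yz yz; set Z := Y :\: _ in xZ Ty Tz.
have [[Y1 yY1] [Y2 zY2]] := (claws y, claws z).
have sz_y := common_side_lt xZ Ty Tz zy' yY1.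
have yz' : y \notin C z by rewrite cnbrC.
have sz_z := common_side_lt xZ Tz Ty yz' zY2.
have := far_common_ge xZ Ty Tz zy'; set T := far x Z in xZ Ty Tz sz_y sz_z *.
suff : #|T :&: C y :&: C z| <= #|[set w in T :&: C y :&: C z | T :\: C y \subset C w]|
          + #|[set w in T :&: C z :&: C y | T :\: C z \subset C w]|.
  by move: sz_y sz_z; clear; lia.
apply: leq_trans (leq_card_setU _ _); apply/subset_leq_card/subsetP => w Ww.
case/orP: (common_split xZ Ty Tz zy' Ww) => Cw; apply/setUP; [left|right].
  by rewrite in_set Ww.
by rewrite in_set setIAC Ww.
Qed.

(** * Covering a neighbourhood by cliques *)

Definition clique Q := forall a b, a \in Q -> b \in Q -> b \in C a.

Lemma exists_max_stable x : (forall Y, ~ claw x Y) ->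
  exists Y, [/\ Y \subset N x, stable Y, #|Y| <= m &
    forall S, S \subset N x -> stable S -> #|S| != #|Y|.+1].
Proof.
move=> noclaw.
pose P Y := [&& Y \subset N x, #|Y| <= m & stableb Y].
have P0 : P set0.
  by rewrite /P sub0set cards0; apply/stableP => a b; rewrite in_set0.
case: (arg_maxnP (fun Y : {set G} => #|Y|) P0) => Y /and3P[Yx Ym /stableP Yst] Ymax.
exists Y; split=> // S Sx Sst; apply/eqP => cS.
have [Sm|mS] := leqP #|S| m.
  have : #|S| <= #|Y| by apply: Ymax; rewrite /P Sx Sm; apply/stableP.
  by rewrite cS ltnn.
by apply: (noclaw S); split=> //; apply/eqP; rewrite eqn_leq mS andbT cS ltnS.
Qed.

Section Cover.

Variables (x : G) (Y : {set G}).
Hypotheses (Yx : Y \subset N x) (Yst : stable Y) (Ym : #|Y| <= m).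
Hypothesis Ymax : forall S, S \subset N x -> stable S -> #|S| != #|Y|.+1.

Local Notation P y := (far x (Y :\ y)).

Lemma private_id y : y \in Y -> y \in P y.
Proof.
move=> Yy; apply/farP; split; first exact: (subsetP Yx).
by move=> t; rewrite in_setD1 => /andP[ty Yt]; apply: Yst; rewrite // eq_sym.
Qed.

(** Two non-adjacent vertices could replace [y] and enlarge [Y]. *)
Lemma private_clique y : y \in Y -> clique (P y).
Proof.
move=> Yy a b /farP[xa aZ] /farP[xb bZ]; apply/negPn/negP => ab.
have aZ' t : t \in b |: (Y :\ y) -> t \notin C a by case/setU1P => [->|/aZ].
apply: (negP (Ymax (S := a |: (b |: (Y :\ y))) _ _)).
- by rewrite !subUset !sub1set xa xb (subset_trans (subsetDl _ _)).
- apply: stableU1 aZ'; apply: stableU1 bZ => c d.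
  by rewrite !in_setD1 => /andP[_ Yc] /andP[_ Yd]; apply: Yst.
by rewrite !cardsU1 (notin_far aZ') (notin_far bZ) (cardsD1 y Y) Yy.
Qed.

Lemma private_card y : y \in Y -> m * M < #|P y|.
Proof.
move=> Yy; have sYx : Y :\ y \subset N x by rewrite (subset_trans (subsetDl _ _)).
have := far_cnbr_ge sYx (private_id Yy).
have : #|P y :&: C y| <= #|P y| by rewrite subset_leq_card // subsetIl.
have : #|Y :\ y| * M + M <= m * M.
  by rewrite addnC -mulSn leq_mul2r; move: Ym; rewrite (cardsD1 y Y) Yy => ->; rewrite orbT.
move: lam_big; clear; lia.
Qed.

Definition spread y := [set w in N x | P y \subset C w].

(** Two non-adjacent members would share all of [P y], which has more than [M] vertices. *)
Lemma spread_clique y : y \in Y -> clique (spread y).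
Proof.
move=> Yy a b /setIdP[xa aP] /setIdP[xb bP]; apply/negPn/negP => ab.
suff /(leq_trans (private_card Yy)) : #|P y| <= M.
  by rewrite ltnNge leq_pmull // (leq_trans _ m_ge4).
apply: leq_trans (card_local_nadj_le xa xb ab).
by rewrite subset_leq_card // !subsetI far_sub aP bP.
Qed.

(** An uncovered [z] would extend to a stable set with one vertex from each [P y], chosen greedily,
    contradicting [Ymax]. *)
Lemma spread_cover : N x \subset \bigcup_(y in Y) spread y.
Proof.
apply/subsetP => z xz; apply/negPn/negP => zQ.
have zP y : y \in Y -> ~~ (P y \subset C z).
  by move=> Yy; apply: contra zQ => yz; apply/bigcupP; exists y; rewrite // in_set xz.
have meet_z y : y \in Y -> #|P y :&: C z| <= M.
  move=> Yy; have /subsetPn[p Pp zp] := zP y Yy.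
  apply: leq_trans (card_local_nadj_le xz (subsetP (far_sub _ _) _ Pp) zp).
  apply/subset_leq_card/subsetP => t; rewrite !in_setI => /andP[Pt zt].
  by rewrite zt (subsetP (far_sub _ _) _ Pt) (private_clique Yy Pp Pt).
suff pick ys : uniq ys -> {subset ys <= Y} -> exists S,
    [/\ S \subset N x, stable S, #|S| = size ys,
        forall t, t \in S -> t \notin C z &
        forall t, t \in S -> exists2 y, y \in ys & t \in P y].
  have [|S [Sx Sst cS Sz _]] := pick (enum Y) (enum_uniq _); first by move=> y; rewrite mem_enum.
  apply: (negP (Ymax (S := z |: S) _ (stableU1 Sst Sz))).
    by rewrite subUset sub1set xz.
  by rewrite cardsU1 (notin_far Sz) cS -cardE.
elim: ys => [_ _|y ys IH /= /andP[ysy uys] sY].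
  by exists set0; split; rewrite ?sub0set ?cards0 // => t; rewrite in_set0.
have [t ys_t|S [Sx Sst cS Sz SP]] := IH uys; first by apply: sY; rewrite in_cons ys_t orbT.
have Yy : y \in Y by apply: sY; rewrite mem_head.
have meet t : t \in z |: S -> #|P y :&: C t| <= M.
  case/setU1P=> [->|St]; first exact: meet_z.
  have [y' ys_y' Pt] := SP t St; have [xt tZ] := farP _ _ _ Pt.
  have ty : y \notin C t.
    apply: tZ; rewrite in_setD1 Yy andbT; apply: contraNneq ysy => ->; exact: ys_y'.
  apply: leq_trans (card_local_nadj_le xt (subsetP Yx _ Yy) ty).
  apply/subset_leq_card/subsetP => c; rewrite !in_setI => /andP[Pc tc].
  by rewrite tc (subsetP (far_sub _ _) _ Pc) (private_clique Yy (private_id Yy) Pc).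
(* At most [m] vertices are already chosen, counting [z], and each excludes at most [M] of the more
   than [m * M] vertices of [P y]. *)
have [p Pp pS] : exists2 p, p \in P y & p \notin \bigcup_(t in z |: S) (P y :&: C t).
  apply/subsetPn; apply/negP => /subset_leq_card; apply/negP; rewrite -ltnNge.
  apply: leq_trans (private_card Yy); rewrite ltnS.
  apply: leq_trans (leq_card_bigcup meet) _.
  rewrite leq_mul2r cardsU1 (notin_far Sz) cS; apply/orP; right.
  apply: leq_trans Ym; rewrite cardE; apply: (@uniq_leq_size _ (y :: ys)) => /=.
    by rewrite ysy uys.
  by move=> t /sY; rewrite mem_enum.
have pS' t : t \in z |: S -> t \notin C p.
  move=> St; apply: contra pS => pt; apply/bigcupP; exists t => //.
  by rewrite in_setI Pp cnbrC.
have pS2 t : t \in S -> t \notin C p by move=> St; apply: pS'; rewrite setU1r.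
exists (p |: S); split.
- by rewrite subUset sub1set (subsetP (far_sub _ _) _ Pp).
- exact: stableU1.
- by rewrite cardsU1 (notin_far pS2) cS.
- by move=> t /setU1P[->|/Sz//]; rewrite cnbrC pS' // setU11.
move=> t /setU1P[->|/SP[y' ys_y' Pt]]; first by exists y; rewrite ?mem_head.
by exists y'; rewrite // in_cons ys_y' orbT.
Qed.

End Cover.

(** At some vertex [x] without a claw, at most [m] cliques cover more than [m * g] neighbours, so
    one exceeds [g]; [x] itself adds one more. *)
Lemma exists_big_clique g : 0 < #|G| -> m * g < k -> exists2 Q, clique Q & g.+1 < #|Q|.
Proof.
move=> G0 mg.
have [x noclaw] : exists x, forall Y, ~ claw x Y.
  pose has_claw u := [exists Y : {set G}, [&& Y \subset N u, stableb Y & #|Y| == m.+1]].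
  have [x nox|all] := pickP (fun u => ~~ has_claw u).
    exists x => Y [Yx Yst cY]; case/negP: nox; apply/existsP; exists Y.
    by rewrite Yx cY eqxx andbT; apply/stableP.
  case: (not_all_claws G0) => u; have /negbFE/existsP[Y /and3P[Yu Yst /eqP cY]] := all u.
  by exists Y; split=> //; apply/stableP.
have [Y [Yx Yst Ym Ymax]] := exists_max_stable noclaw.
have [y Yy gy] : exists2 y, y \in Y & g < #|spread x Y y|.
  apply/exists_inP; apply: contraLR mg; rewrite negb_exists_in => /forall_inP small.
  rewrite -leqNgt -(degree x).
  apply: leq_trans (subset_leq_card (spread_cover Yx Yst Ym Ymax)) _.
  apply: (@leq_trans (#|Y| * g)); last by rewrite leq_mul2r Ym orbT.
  by apply: leq_card_bigcup => y /small; rewrite -leqNgt.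
exists (x |: spread x Y y).
  move=> a b /setU1P[->|Qa] /setU1P[->|Qb].
  - exact: cnbr_id.
  - by case/setIdP: Qb => /nbr_cnbr.
  - by case/setIdP: Qa => /nbr_cnbr; rewrite cnbrC.
  exact: (spread_clique Yx Yst Ym Yy Qa Qb).
by rewrite cardsU1 in_set nbr_irr.
Qed.

(* The variance-type bound from [(m * d - mu) ^ 2 >= 0], where [d] is the number of
   neighbours in the clique. *)
Lemma clique_count mu Q : clique Q ->
  #|Q| * (m * #|Q|.-1 - mu) ^ 2 + 2 * m * mu * (#|Q| * k)
    <= m ^ 2 * (#|Q| * k + #|Q| * (#|Q|.-1 * lam)) + mu ^ 2 * #|G|.
Proof.
move=> Qcl; pose d w := #|[set y in Q | w \in N y]|.
have sum1 : \sum_(w in [set: G]) d w = #|Q| * k.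
  rewrite sum_card_count -sum_nat_const; apply: eq_bigr => y _.
  by rewrite -(degree y); apply: eq_card => w; rewrite !inE.
have sum2 : \sum_(w in [set: G]) d w ^ 2 = #|Q| * k + #|Q| * (#|Q|.-1 * lam).
  rewrite sum_card_sq -!sum_nat_const -big_split /=.
  apply: eq_bigr => y Qy; rewrite (big_setD1 y) //=; congr (_ + _).
    by rewrite -(degree y); apply: eq_card => w; rewrite in_set in_setT andbb.
  have -> : #|Q|.-1 = #|Q :\ y| by rewrite (cardsD1 y Q) Qy.
  rewrite -sum_nat_const; apply: eq_bigr => z; rewrite in_setD1 => /andP[zy Qz].
  rewrite -(@card_adj y z); last first.
    by have := Qcl y z Qy Qz; rewrite in_cnbr (negPf zy).
  by apply: eq_card => w; rewrite in_set in_setT in_setI.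
have sumQ : \sum_(w in [set: G]) (w \in Q) * (m * #|Q|.-1 - mu) ^ 2
    = #|Q| * (m * #|Q|.-1 - mu) ^ 2.
  rewrite -big_distrl /=; congr (_ * _).
  rewrite -sum1_card big_mkcond [RHS]big_mkcond /=.
  by apply: eq_bigr => w _; rewrite in_setT; case: (w \in Q).
rewrite -sum2 -sum1 -sumQ !big_distrr -(cardsT G) /= -big_split /=.
rewrite (mulnC _ #|_|) -sum_nat_const -big_split /=.
(* Vertices of [Q] have [d w = |Q| - 1] and keep their square; elsewhere the square is discarded. *)
apply: leq_sum => w _; case Qw : (w \in Q).
  have -> : d w = #|Q|.-1.
    rewrite (cardsD1 w Q) Qw; apply: eq_card => y; rewrite in_set in_setD1.
    case: (eqVneq y w) => [->|yw] /=; first by rewrite nbr_irr andbF.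
    case Qy : (y \in Q) => //=; have := Qcl y w Qy Qw.
    by rewrite in_cnbr in_nbr eq_sym (negPf yw).
  have := leq_sqr_sub (m * #|Q|.-1) mu.
  by rewrite mul1n expnMn -!mulnA (mulnC mu).
have := leq_sqr_sub (m * d w) mu; rewrite mul0n add0n expnMn -!mulnA (mulnC mu).
by apply: leq_trans; apply: leq_addl.
Qed.

End Claws.

(* With [c = lambda + 2 * m - m ^ 3] and [V = 8 * mu * v], this is the failure of
   [clique_count] for a clique of size [c], multiplied by [8]. *)
Lemma clique_count_fails (n k2 l2 c2 mu m V : nat) :
  m = n + 4 -> mu = m ^ 3 + m ^ 2 + 2 ->
  l2 + 4 * m = m ^ 5 + m ^ 3 + 4 * m ^ 2 + 2 ->
  c2 + 2 * m ^ 3 = l2 + 4 * m -> k2 + 4 * m = m * c2 + 4 ->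
  V + 2 * k2 * (l2 + 2) = mu * (8 + 4 * k2) + 2 * k2 * k2 ->
  m ^ 2 * (2 * c2 * k2 + c2 * (c2 - 2) * l2) + mu * V <
    c2 * (m * (c2 - 2) - 2 * mu) ^ 2 + 4 * m * mu * c2 * k2.
Proof.
move=> em emu el ec ek ev.
(* Each quantity, truncated differences included, becomes a polynomial in [n = m - 4] with
   non-negative coefficients. *)
have {}el : l2 = n ^ 5 + 20 * n ^ 4 + 161 * n ^ 3 + 656 * n ^ 2 + 1356 * n + 1138.
  by move: el; rewrite em; clear; lia.
have {}ec : c2 - 2 = n ^ 5 + 20 * n ^ 4 + 159 * n ^ 3 + 632 * n ^ 2 + 1264 * n + 1024.
  by move: ec; rewrite el em; clear; lia.
have ec2 : c2 = n ^ 5 + 20 * n ^ 4 + 159 * n ^ 3 + 632 * n ^ 2 + 1264 * n + 1026.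
  by move: ec; clear; lia.
have {}ek : k2 =
    n ^ 6 + 24 * n ^ 5 + 239 * n ^ 4 + 1268 * n ^ 3 + 3792 * n ^ 2 + 2 * 3039 * n + 4092.
  by move: ek; rewrite ec2 em; clear; lia.
have {}emu : mu = n ^ 3 + 13 * n ^ 2 + 56 * n + 82.
  by rewrite emu em; clear; lia.
have evm : mu * V + mu * (2 * k2 * (l2 + 2)) = mu * (mu * (8 + 4 * k2) + 2 * k2 * k2).
  by rewrite -mulnDr ev.
have ed : m * (c2 - 2) - 2 * mu =
    n ^ 6 + 24 * n ^ 5 + 239 * n ^ 4 + 1266 * n ^ 3 + 3766 * n ^ 2 + 2 * 2984 * n + 3932.
  rewrite ec em emu; clear; lia.
rewrite ed ec.
move: evm; move: (mu * V) => W; rewrite ec2 ek el emu em; clear.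
have e k : n ^ k.+1 = n * n ^ k by rewrite expnS.
rewrite !e expn0 muln1.
nia.
Qed.

(** * Strongly regular graphs with the given parameters *)

Lemma subset_of_card (T : finType) (A : {set T}) n :
  n <= #|A| -> exists2 B : {set T}, B \subset A & #|B| = n.
Proof.
case/card_geqP => r [r_uniq r_size rA]; exists [set t in r].
  by apply/subsetP => t; rewrite inE => /rA.
by rewrite cardsE (card_uniqP r_uniq).
Qed.

Lemma srg_card_nadj (G : sgraph) v k lam mu (x y : G) :
  strongly_regular G v k lam mu -> y \notin cnbr x -> 
  #|neighbors x :&: neighbors y| = mu.
Proof.
move=> [[_ dist2] diam]; rewrite in_cnbr negb_or => /andP[yx xy].
apply: dist2; have [[|[|[|d]]] // _ dist] := diam x y; case: (dist) => -[p [px py] sp] _.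
- by case: p px py sp => //= _ xy_eq; rewrite xy_eq eqxx in yx.
- case: p px py sp => [|a []] //= /andP[xa _] ay _.
  by rewrite -ay xa in xy.
Qed.

(** The parameter formulas are expanded in powers of [m] and cleared of denominators, so that
    everything stays in [nat]. *)
Lemma no_srg (G : sgraph) (n v k lam mu m : nat) : m = n + 4 ->
  mu = m ^ 3 + m ^ 2 + 2 -> 2 * lam + 4 * m = m ^ 5 + m ^ 3 + 4 * m ^ 2 + 2 ->
  2 * k + m ^ 4 + 2 * m = m ^ 6 + 4 * m ^ 3 + 4 ->
  mu * v + k * (lam + 1) = mu * (1 + k) + k * k ->
  ~ strongly_regular G v k lam mu.
Proof.
move=> em emu el ek ev srg.
have card_nadj x y := @srg_card_nadj G v k lam mu x y srg.
case: srg => [[[cG degree card_adj] _] _].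
pose M := m ^ 3 + m ^ 2 + 1; have muM : mu = M.+1 by rewrite emu addnS.
pose s := (m * m.-1)./2.
have s_def : s * 2 = m * m.-1.
  rewrite muln2 /s -[RHS]odd_double_half oddM -subn1 oddB; last by rewrite em addn4.
  by rewrite addbT andbN.
have expE i : n ^ i.+1 = n * n ^ i by rewrite expnS.
have s2 : s * 2 = n ^ 2 + 7 * n + 12.
  by rewrite s_def em addn4 /=; clear; lia.
have EM : M = n ^ 3 + 13 * n ^ 2 + 56 * n + 81.
  by rewrite /M em; clear; lia.
have El : 2 * lam = n ^ 5 + 20 * n ^ 4 + 161 * n ^ 3 + 656 * n ^ 2 + 1356 * n + 1138.
  by move: el; rewrite em; clear; lia.
have Ek : 2 * k =
    n ^ 6 + 24 * n ^ 5 + 239 * n ^ 4 + 1268 * n ^ 3 + 3792 * n ^ 2 + 2 * 3039 * n + 4092.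
  by move: ek; rewrite em; clear; lia.
have m_ge4 : 3 < m by rewrite em addn4.
have s_gt0 : 0 < s by move: s2; clear; lia.
have lam_big : 2 * (m * M) <= lam + M.
  by move: El EM; rewrite em !expE expn0 muln1; clear; nia.
have sM : 10 * s <= M.
  by move: s2 EM; rewrite !expE expn0 muln1; clear; nia.
have k_eq : 2 * k + m.+1 * (m * M) = 2 * (m.+1 * lam.+1) + m * m.-1.
  have -> : 2 * (m.+1 * lam.+1) = m.+1 * (2 * lam) + 2 * m.+1 by clear; lia.
  by rewrite -s_def s2 El Ek EM em; clear; lia.
(* Chosen so that [k = m * g + 2]: more than [m * g], yet too small for a clique of [g + 2]
   vertices. *)
pose g := lam + 2 * m - (m ^ 3 + 2).
have Eg : 2 * g = n ^ 5 + 20 * n ^ 4 + 159 * n ^ 3 + 632 * n ^ 2 + 1264 * n + 1022.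
  rewrite /g mulnBr mulnDr El em; clear; lia.
have kg : 2 * k = 2 * (m * g) + 4.
  have -> : 2 * (m * g) = m * (2 * g) by clear; lia.
  by rewrite Eg Ek em; clear; lia.
(* If [v = 0], then [ev] would give [k * (lam + 1) = mu * (1 + k) + k * k], impossible since
   [lam + 1 <= k]. *)
have G0 : 0 < #|G|.
  rewrite cG lt0n; apply: contraPneq ev => ->; rewrite muln0 add0n => ev.
  have lk : lam + 1 <= k by move: El Ek; rewrite !expE expn0 muln1; clear; nia.
  have : k * (lam + 1) <= k * k by rewrite leq_mul2l lk orbT.
  by rewrite ev muM; clear; lia.
have [Q Qcl gQ] : exists2 Q : {set G}, clique Q & g.+1 < #|Q|.
  apply: (exists_big_clique degree card_adj _ m_ge4 s_gt0 s_def k_eq lam_big sM G0).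
    by move=> x y xy; rewrite -muM; apply: card_nadj.
  by move: kg; clear; lia.
have [R RQ cR] := subset_of_card gQ.
have Rcl : clique R by move=> a b /(subsetP RQ) Qa /(subsetP RQ) Qb; apply: Qcl.
have := clique_count m degree card_adj mu Rcl; rewrite cR cG /=.
have := @clique_count_fails n (2 * k) (2 * lam) (2 * g.+2) mu m (8 * (mu * v)) em emu el.
have -> : 2 * g.+2 - 2 = 2 * g.+1 by clear; lia.
have -> : m * (2 * g.+1) - 2 * mu = 2 * (m * g.+1 - mu) by rewrite mulnBr mulnCA.
(* The factor 8 comes from products of three doubled quantities. *)
move: (m * g.+1 - mu) => X lt le; suff : 8 * (m ^ 2 * (g.+2 * k + g.+2 * (g.+1 * lam)) + mu ^ 2 * v)
    < 8 * (g.+2 * X ^ 2 + 2 * m * mu * (g.+2 * k)).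
  by rewrite ltn_pmul2l // ltnNge le.
have {}lt := lt _ _ _; rewrite (_ : 8 * (m ^ 2 * _ + _) =
    m ^ 2 * (2 * (2 * g.+2) * (2 * k) + 2 * g.+2 * (2 * g.+1) * (2 * lam)) + mu * (8 * (mu * v))).
  rewrite (_ : 8 * (g.+2 * _ + _) =
    2 * g.+2 * (2 * X) ^ 2 + 4 * m * mu * (2 * g.+2) * (2 * k)).
    apply: lt.
    - by move: Eg El; rewrite em; clear; lia.
    - by move: kg; clear; lia.
    by move: ev; clear; lia.
  by clear; lia.
by clear; lia.
Qed.

(** * Passage from the rational formulas to natural numbers *)

Local Open Scope ring_scope.

Theorem theorem4p3 (m : int) (hm : 4 <= m) (v k lambda mu : nat)
  (hmu : mu%:R =
     (m%:~R - 3) ^+ 3 + 10 * (m%:~R - 3) ^+ 2 + 33 * (m%:~R - 3) + 38 :> rat)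
  (hlambda : lambda%:R =
     ((m%:~R - 3) ^+ 5 + 15 * (m%:~R - 3) ^+ 4 + 91 * (m%:~R - 3) ^+ 3
        + 283 * (m%:~R - 3) ^+ 2) / 2
     + 226 * (m%:~R - 3) + 148 :> rat)
  (hk : k%:R =
     (m%:~R + 1) * (m%:~R * (2 - mu%:R) + 2 * lambda%:R) / 2 + 1 :> rat)
  (hv : v%:R = 1 + k%:R + k%:R * (k%:R - lambda%:R - 1) / mu%:R :> rat) :
  ~ exists G : sgraph, strongly_regular G v k lambda mu.
Proof.
case=> G; have [n em] : exists n, m = (n + 4)%N%:Z.
  by exists `|m - 4|%N; move: hm; clear; lia.
have [p ep] : exists p, p = (n + 4)%N by exists (n + 4)%N.
have mp : m%:~R = p%:R :> rat by rewrite em -ep.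
rewrite mp in hmu hlambda hk.
have emu : mu = (p ^ 3 + p ^ 2 + 2)%N.
  by apply/eqP; rewrite -(eqr_nat rat) hmu !natrD !natrX; apply/eqP; ring.
have mu0 : mu%:R != 0 :> rat by rewrite pnatr_eq0 emu addn2.
have mu_def : mu%:R = p%:R ^+ 3 + p%:R ^+ 2 + 2 :> rat by rewrite emu !natrD !natrX.
(* The remaining identities are checked in [rat], where the halves and the division by [mu] are
   exact. *)
apply: (@no_srg G n v k lambda mu p) => //; apply/eqP; rewrite -(eqr_nat rat).
- by rewrite !(natrD, natrX, natrM) hlambda; apply/eqP; field.
- by rewrite !(natrD, natrX, natrM) hk hlambda mu_def; apply/eqP; field.
by rewrite !(natrD, natrM) hv; apply/eqP; field.
Qed.
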